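(* Let $\mathcal{D}$ be a triangulated category with a presilting subcategory $\mathcal{P}$ such that $\mathcal{P}$ is contravariantly finite in $\mathcal{D}$, there is an integer $m<0$ with $\operatorname{Hom}(\mathcal{P},\mathcal{P}[i])=0$ for all $i<m$, and $(\mathcal{D}^{\le 0}_{\mathcal{P}},\mathcal{D}^{\ge 0}_{\mathcal{P}})$ is a non-degenerate $t$-structure on $\mathcal{D}$. Let $d$ be a positive integer and $d\text{-}\mathcal{H}=\mathcal{D}^{[-d+1,0]}$. Assume $\mathcal{P}\subseteq d\text{-}\mathcal{H}$ and that $d\text{-}\mathcal{H}$ has enough injectives; let $\mathcal{I}$ be the full subcategory of $\mathbb{E}$-injective objects of $d\text{-}\mathcal{H}$. Then for any contravariantly finite $\mathbb{E}$-universal subcategory $\mathcal{M}$ of $d\text{-}\mathcal{H}$, the following statements are equivalent. (1) $\mathcal{M}$ is a tilting subcategory of $d\text{-}\mathcal{H}$. (2) $\mathcal{T}(\mathcal{M})=\operatorname{Fac}_d(\mathcal{M})$. (3) $\mathcal{M}$ is a quasi-tilting subcategory of $d\text{-}\mathcal{H}$ satisfying $\mathcal{I}\subseteq\operatorname{Fac}_d(\mathcal{M})$.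
   Context: Conventions: $[1]$ is the shift functor of a triangulated category. $\operatorname{add}\mathcal{X}$ is the full subcategory of direct summands of finite direct sums of objects of $\mathcal{X}$. A subcategory of an additive category means a full subcategory $\mathcal{X}$ with $\mathcal{X}=\operatorname{add}\mathcal{X}$. $\operatorname{Hom}(\mathcal{X},\mathcal{Y})=0$ means $\operatorname{Hom}(X,Y)=0$ for all $X\in\mathcal{X}$, $Y\in\mathcal{Y}$, similarly for other bifunctors. A morphism $f:X\to Y$ is a right $\mathcal{X}$-approximation of $Y$ if $X\in\mathcal{X}$ and every morphism $X'\to Y$ with $X'\in\mathcal{X}$ factors through $f$; $\mathcal{X}$ is contravariantly finite in $\mathcal{C}$ if every object of $\mathcal{C}$ has a right $\mathcal{X}$-approximation. $\mathcal{P}$ is presilting if $\operatorname{Hom}(\mathcal{P},\mathcal{P}[i])=0$ for all $i>0$. $\mathcal{D}^{\le 0}_{\mathcal{P}}=\{Y\in\mathcal{D}\mid \operatorname{Hom}(\mathcal{P},Y[i])=0\ \forall i>0\}$, $\mathcal{D}^{\ge 0}_{\mathcal{P}}=\{Y\in\mathcal{D}\mid \operatorname{Hom}(\mathcal{P},Y[i])=0\ \forall i<0\}$, $\mathcal{D}^{\le q}=\mathcal{D}^{\le 0}_{\mathcal{P}}[-q]$, $\mathcal{D}^{\ge q}=\mathcal{D}^{\ge 0}_{\mathcal{P}}[-q]$, $\mathcal{D}^{[p,q]}=\mathcal{D}^{\le q}\cap\mathcal{D}^{\ge p}$. For $M,N\in d\text{-}\mathcal{H}$ and $i>0$ put $\mathbb{E}^i(M,N)=\operatorname{Hom}(M,N[i])$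 and $\mathbb{E}=\mathbb{E}^1$. An extriangle is a sequence $N\to L\to M$ with $N,L,M\in d\text{-}\mathcal{H}$ that is part of a triangle $N\to L\to M\to N[1]$ in $\mathcal{D}$. For a full subcategory $\mathcal{X}$ of $d\text{-}\mathcal{H}$ and $s\ge1$, $\operatorname{Fac}_s(\mathcal{X})$ is the full subcategory of objects $Z_0\in d\text{-}\mathcal{H}$ for which there are extriangles $Z_i\to X_i\to Z_{i-1}$, $1\le i\le s$, with $X_1,\dots,X_s\in\mathcal{X}$. An object $M$ of a full subcategory $\mathcal{X}\subseteq d\text{-}\mathcal{H}$ is $\mathbb{E}$-projective (resp. $\mathbb{E}$-injective) in $\mathcal{X}$ if $\mathbb{E}(M,X)=0$ (resp. $\mathbb{E}(X,M)=0$) for all $X\in\mathcal{X}$. $d\text{-}\mathcal{H}$ has enough injectives if every $X\in d\text{-}\mathcal{H}$ admits an extriangle $X\to I\to Y$ with $I\in\mathcal{I}$. (When $\mathcal{P}\subseteq d\text{-}\mathcal{H}$, $\mathcal{P}$ is the class of $\mathbb{E}$-projective objects of $d\text{-}\mathcal{H}$, and $d\text{-}\mathcal{H}$ has enough projectives.) $\mathcal{T}(\mathcal{M})=\{X\in d\text{-}\mathcal{H}\mid \mathbb{E}^i(\mathcal{M},X)=0\ \forall i>0\}$. A subcategory $\mathcal{M}$ of $d\text{-}\mathcal{H}$ is $\mathbb{E}$-universal if for any $X\in d\text{-}\mathcal{H}$ there is an extriangle $X\to Y\to M$ with $M\in\mathcal{M}$ such that for any $M'\in\mathcal{M}$ the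 induced map $\operatorname{Hom}(M',M)\to\mathbb{E}(M',X)$ is surjective. ''Contravariantly finite'' for $\mathcal{M}$ means contravariantly finite in $d\text{-}\mathcal{H}$. $M\in d\text{-}\mathcal{H}$ has projective dimension at most $n$ if there are extriangles $Z_i\to P_{i-1}\to Z_{i-1}$, $i>0$, with $Z_0=M$, all $P_{i-1}\in\mathcal{P}$, and $Z_n\in\mathcal{P}$. A subcategory $\mathcal{M}$ of $d\text{-}\mathcal{H}$ is tilting if: every object of $\mathcal{M}$ has projective dimension at most $d$; $\mathbb{E}^i(\mathcal{M},\mathcal{M})=0$ for all $i>0$; and for any $P\in\mathcal{P}$ there are extriangles $Y_{i-1}\to M_{i-1}\to Y_i$, $1\le i\le r$, for some $r$, with $Y_0=P$ and $M_0,\dots,M_{r-1},Y_r\in\mathcal{M}$. It is quasi-tilting if every object of $\mathcal{M}$ is $\mathbb{E}$-projective in $\operatorname{Fac}_d(\mathcal{M})$ and $\operatorname{Fac}_d(\mathcal{M})=\operatorname{Fac}_{d+1}(\mathcal{M})$. *)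

(* Defs.v *)
From mathcomp Require Import all_boot all_order all_algebra.
Set Implicit Arguments.
Unset Strict Implicit.
Unset Printing Implicit Defensive.
Import Order.TTheory GRing.Theory Num.Theory.
Local Open Scope ring_scope.

Record preadditive := Preadditive {
  obj :> Type;
  hom : obj -> obj -> zmodType;
  idm : forall X : obj, hom X X;
  comp : forall X Y Z : obj, hom Y Z -> hom X Y -> hom X Z;
  comp_idl : forall X Y (f : hom X Y), comp (idm Y) f = f;
  comp_idr : forall X Y (f : hom X Y), comp f (idm X) = f;
  compA : forall W X Y Z (h : hom Y Z) (g : hom X Y) (f : hom W X),
    comp h (comp g f) = comp (comp h g) f;
  compDl : forall X Y Z (g g' : hom Y Z) (f : hom X Y),
    comp (g + g') f = comp g f + comp g' f;
  compDr : forall X Y Z (g : hom Y Z) (f f' : hom X Y),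
    comp g (f + f') = comp g f + comp g f'
}.
Arguments hom {p}.
Arguments idm {p}.
Arguments comp {p X Y Z}.

Notation "g \oc f" := (comp g f) (at level 40, left associativity).

Definition is_iso (C : preadditive) (X Y : C) (f : hom X Y) : Prop :=
  exists g : hom Y X, g \oc f = idm X /\ f \oc g = idm Y.

Definition isomorphic (C : preadditive) (X Y : C) : Prop :=
  exists f : hom X Y, is_iso f.

Definition is_zero (C : preadditive) (X : C) : Prop := idm X = 0.

Definition hom_zero (C : preadditive) (X Y : C) : Prop :=
  forall f : hom X Y, f = 0.

Definition is_direct_sum (C : preadditive) (I : finType) (X : I -> C) (Z : C)
    : Prop :=
  exists (inj : forall i, hom (X i) Z) (proj : forall i, hom Z (X i)),
    [/\ forall i, proj i \oc inj i = idm (X i),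
        forall i j, i != j -> proj j \oc inj i = 0
      & \sum_i inj i \oc proj i = idm Z].

(** The case n = 0 provides a zero object. *)
Record additive_cat := AdditiveCat {
  additive_base :> preadditive;
  has_direct_sums : forall (n : nat) (X : 'I_n -> additive_base),
    exists Z : additive_base, is_direct_sum X Z
}.

Record additive_functor (C D : preadditive) := AdditiveFunctor {
  fobj :> C -> D;
  fmap : forall X Y : C, hom X Y -> hom (fobj X) (fobj Y);
  fmap_id : forall X : C, fmap (idm X) = idm (fobj X);
  fmap_comp : forall (X Y Z : C) (g : hom Y Z) (f : hom X Y),
    fmap (g \oc f) = fmap g \oc fmap f;
  fmapD : forall (X Y : C) (f g : hom X Y), fmap (f + g) = fmap f + fmap g
}.
Arguments fmap {C D} a {X Y}.

(** The shift is an autoequivalence, with a chosen quasi-inverse; it is not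
    required to be an automorphism.  [dist f g h] says that
    X -f-> Y -g-> Z -h-> X[1] is a distinguished triangle. *)
Record triangulated := Triangulated {
  tri_base :> additive_cat;
  shift : additive_functor tri_base tri_base;
  unshift : additive_functor tri_base tri_base;
  shift_unit : forall X : tri_base, hom X (unshift (shift X));
  shift_unit_iso : forall X, is_iso (shift_unit X);
  shift_unit_nat : forall (X Y : tri_base) (f : hom X Y),
    shift_unit Y \oc f = fmap unshift (fmap shift f) \oc shift_unit X;
  shift_counit : forall X : tri_base, hom (shift (unshift X)) X;
  shift_counit_iso : forall X, is_iso (shift_counit X);
  shift_counit_nat : forall (X Y : tri_base) (f : hom X Y),
    f \oc shift_counit X = shift_counit Y \oc fmap shift (fmap unshift f);
  dist : forall X Y Z : tri_base,
    hom X Y -> hom Y Z -> hom Z (shift X) -> Prop;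
  dist_iso : forall (X Y Z X' Y' Z' : tri_base)
      (f : hom X Y) (g : hom Y Z) (h : hom Z (shift X))
      (f' : hom X' Y') (g' : hom Y' Z') (h' : hom Z' (shift X'))
      (a : hom X X') (b : hom Y Y') (c : hom Z Z'),
    is_iso a -> is_iso b -> is_iso c ->
    b \oc f = f' \oc a -> c \oc g = g' \oc b ->
    fmap shift a \oc h = h' \oc c ->
    dist f g h -> dist f' g' h';
  dist_id : forall X Z : tri_base, is_zero Z ->
    dist (idm X) (0 : hom X Z) (0 : hom Z (shift X));
  dist_complete : forall (X Y : tri_base) (f : hom X Y),
    exists (Z : tri_base) (g : hom Y Z) (h : hom Z (shift X)), dist f g h;
  dist_rotate : forall (X Y Z : tri_base)
      (f : hom X Y) (g : hom Y Z) (h : hom Z (shift X)),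
    dist f g h <-> dist g h (- fmap shift f);
  dist_morphism : forall (X Y Z X' Y' Z' : tri_base)
      (f : hom X Y) (g : hom Y Z) (h : hom Z (shift X))
      (f' : hom X' Y') (g' : hom Y' Z') (h' : hom Z' (shift X'))
      (a : hom X X') (b : hom Y Y'),
    dist f g h -> dist f' g' h' -> b \oc f = f' \oc a ->
    exists c : hom Z Z', c \oc g = g' \oc b /\ fmap shift a \oc h = h' \oc c;
  dist_octahedral : forall (X Y Z A B C : tri_base)
      (f : hom X Y) (u : hom Y A) (u' : hom A (shift X))
      (g : hom Y Z) (v : hom Z B) (v' : hom B (shift Y))
      (w : hom Z C) (w' : hom C (shift X)),
    dist f u u' -> dist g v v' -> dist (g \oc f) w w' ->
    exists (a : hom A C) (b : hom C B),
      dist a b (fmap shift u \oc v') /\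
      [/\ a \oc u = w \oc g, w' \oc a = u',
          b \oc w = v & v' \oc b = fmap shift f \oc w']
}.
Arguments shift {t}.
Arguments unshift {t}.
Arguments dist {t X Y Z}.

(** [shiftn i X] is X[i]. *)
Definition shiftn (D : triangulated) (i : int) (X : D) : D :=
  match i with
  | Posz n => iter n (fobj shift) X
  | Negz n => iter n.+1 (fobj unshift) X
  end.

Definition full_subcat (C : preadditive) := C -> Prop.

Section Subcategories.
Variable C : preadditive.
Implicit Types (A B X : full_subcat C).

Definition subcat_incl A B : Prop := forall Y, A Y -> B Y.

Definition subcat_eq A B : Prop := forall Y, A Y <-> B Y.

Definition strictly_full A : Prop :=
  forall Y Y', isomorphic Y Y' -> A Y -> A Y'.

Definition direct_summand (Y Z : C) : Prop :=
  exists Y' : C, is_direct_sum (fun b : bool => if b then Y else Y') Z.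

Definition add_closure X : full_subcat C := fun Y =>
  exists (n : nat) (F : 'I_n -> C) (Z : C),
    [/\ forall i, X (F i), is_direct_sum F Z & direct_summand Y Z].

Definition subcategory X : Prop := subcat_eq X (add_closure X).

Definition right_approximation X (Z Y : C) (f : hom Z Y) : Prop :=
  X Z /\ forall (Z' : C) (g : hom Z' Y), X Z' ->
    exists k : hom Z' Z, g = f \oc k.

Definition contravariantly_finite X A : Prop :=
  forall Y, A Y -> exists (Z : C) (f : hom Z Y), right_approximation X f.

End Subcategories.

Section Triangulated.
Variable D : triangulated.
Implicit Types (A B P M : full_subcat D) (p q : int).

(** A[i], closed under isomorphism since the shift is only an equivalence. *)
Definition shift_subcat A (i : int) : full_subcat D := fun Y =>
  exists Z, A Z /\ isomorphic Y (shiftn i Z).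

Record t_structure A B : Prop := TStructure {
  t_le_strict : strictly_full A;
  t_ge_strict : strictly_full B;
  t_le_shift : forall Y, A Y -> A (shiftn 1 Y);
  t_ge_shift : forall Y, B Y -> B (shiftn (-1) Y);
  t_hom_zero : forall Y Z, A Y -> B Z -> hom_zero Y (shiftn (-1) Z);
  t_triangle : forall Y, exists (U V : D)
      (f : hom U Y) (g : hom Y V) (h : hom V (shift U)),
    [/\ A U, shift_subcat B (-1) V & dist f g h]
}.

Definition non_degenerate A B : Prop :=
  (forall Y, (forall q, shift_subcat A (- q) Y) -> is_zero Y) /\
  (forall Y, (forall q, shift_subcat B (- q) Y) -> is_zero Y).

Definition presilting P : Prop :=
  subcategory P /\
  forall i : int, 0 < i -> forall X Y, P X -> P Y -> hom_zero X (shiftn i Y).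

Definition Dle0 P : full_subcat D := fun Y =>
  forall i : int, 0 < i -> forall X, P X -> hom_zero X (shiftn i Y).

Definition Dge0 P : full_subcat D := fun Y =>
  forall i : int, i < 0 -> forall X, P X -> hom_zero X (shiftn i Y).

Definition Dle P q : full_subcat D := shift_subcat (Dle0 P) (- q).

Definition Dge P q : full_subcat D := shift_subcat (Dge0 P) (- q).

Definition Dinterval P p q : full_subcat D := fun Y => Dle P q Y /\ Dge P p Y.

Definition extended_heart P (d : nat) : full_subcat D :=
  Dinterval P (- d%:Z + 1) 0.

(** To be instantiated with an extended heart of a t-structure. *)
Variable H : full_subcat D.

(** The assertion that all the groups E^i(Y, Z) = Hom(Y, Z[i]) vanish is
    [forall i, 0 < i -> Ext_zero i Y Z]. *)
Definition Ext_zero (i : nat) (Y Z : D) : Prop := hom_zero Y (shiftn i%:Z Z).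

Definition extriangle_with (N L M : D)
    (f : hom N L) (g : hom L M) (h : hom M (shift N)) : Prop :=
  [/\ H N, H L, H M & dist f g h].

Definition extriangle (N L M : D) : Prop :=
  exists (f : hom N L) (g : hom L M) (h : hom M (shift N)),
    extriangle_with f g h.

(** Only the values Z 0, ..., Z s and T 1, ..., T s matter. *)
Definition Fac (s : nat) (X : full_subcat D) : full_subcat D := fun Z0 =>
  H Z0 /\
  exists Z T : nat -> D, Z 0%N = Z0 /\
    forall i, (1 <= i <= s)%N -> X (T i) /\ extriangle (Z i) (T i) (Z i.-1).

Definition E_projective (X : full_subcat D) : full_subcat D := fun Y =>
  X Y /\ forall Z, X Z -> Ext_zero 1 Y Z.

Definition E_injective (X : full_subcat D) : full_subcat D := fun Y =>
  X Y /\ forall Z, X Z -> Ext_zero 1 Z Y.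

Definition enough_injectives : Prop :=
  forall Y, H Y -> exists I Z, E_injective H I /\ extriangle Y I Z.

Definition T_class M : full_subcat D := fun Y =>
  H Y /\ forall i, (0 < i)%N -> forall Z, M Z -> Ext_zero i Z Y.

Definition E_universal M : Prop :=
  forall Y, H Y -> exists (L N : D)
      (f : hom Y L) (g : hom L N) (h : hom N (shift Y)),
    [/\ M N, extriangle_with f g h
      & forall N', M N' -> forall e : hom N' (shift Y),
          exists k : hom N' N, h \oc k = e].

(** The resolution is infinite; its tail past Z n is immaterial, since it can
    always be continued by Z n and zero objects. *)
Definition projdim_le P (n : nat) (Y : D) : Prop :=
  exists Z Q : nat -> D, [/\ Z 0%N = Y,
    forall i, (0 < i)%N -> P (Q i.-1) /\ extriangle (Z i) (Q i.-1) (Z i.-1)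
    & P (Z n)].

Record tilting P (d : nat) M : Prop := Tilting {
  tilting_projdim : forall Y, M Y -> projdim_le P d Y;
  tilting_rigid : forall i, (0 < i)%N ->
    forall Y Z, M Y -> M Z -> Ext_zero i Y Z;
  tilting_coresolution : forall Q, P Q -> exists (r : nat) (Y N : nat -> D),
    [/\ Y 0%N = Q,
        forall i, (1 <= i <= r)%N ->
          M (N i.-1) /\ extriangle (Y i.-1) (N i.-1) (Y i)
      & M (Y r)]
}.

Definition quasi_tilting (d : nat) M : Prop :=
  (forall Y, M Y -> E_projective (Fac d M) Y) /\
  subcat_eq (Fac d M) (Fac d.+1 M).

End Triangulated.

(* Main.v *)
(** Let H be the extended heart and F = Fac_d(M).  The class P consists of
    Ext-projectives of H, and H has enough of them, so dimension shifting is
    available along projective and injective (co)resolutions.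

    (1) => (2): projective dimension at most d makes Ext^i(M, F) vanish.
    Conversely, by the coresolutions of P every map from P to an object X of
    T(M) factors through M; hence the cocone of an M-approximation of X lies in
    H, and again in T(M).  The same cocone argument gives
    T(M) = Fac_{d+1}(M) in (2) => (3).

    (3) => (2): the key point is that the cone of a map from an object of
    Fac_s(M) to one of F lies in Fac_{s+1}(M) as soon as it lies in H.  It makes
    F closed under extensions, and, as F contains the injectives, puts the d-th
    cosyzygy of any object in F; Ext^i(M, F) = 0 follows by dimension shifting.
    Going back down an injective coresolution of X in T(M), each cosyzygy is a
    direct summand of an object of F, hence the cone of a map from M to F.

    (2) => (1): the cosyzygy argument bounds the projective dimension.  The dual
    Auslander-Buchweitz construction gives triangles Q -> X -> S with X in F and
    S finitely coresolved by M; for Q in P, the object X is Ext-projective in F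
    and therefore belongs to M. *)
From mathcomp Require Import all_boot all_order all_algebra.
From mathcomp Require Import zify.
Require Import Defs.
Set Implicit Arguments.
Unset Strict Implicit.
Unset Printing Implicit Defensive.
Import Order.TTheory GRing.Theory Num.Theory.
Local Open Scope ring_scope.

(** * Isomorphisms, zero objects and direct summands in preadditive categories *)

Section Preadditive.
Variable C : preadditive.
Implicit Types X Y Z W O : C.

Lemma comp0l X Y Z (f : hom X Y) : (0 : hom Y Z) \oc f = 0.
Proof. by apply: (addrI (0 \oc f)); rewrite -compDl !addr0. Qed.

Lemma comp0r X Y Z (g : hom Y Z) : g \oc (0 : hom X Y) = 0.
Proof. by apply: (addrI (g \oc 0)); rewrite -compDr !addr0. Qed.

Lemma compNl X Y Z (g : hom Y Z) (f : hom X Y) : (- g) \oc f = - (g \oc f).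
Proof. by apply: (addrI (g \oc f)); rewrite -compDl !addrN comp0l. Qed.

Lemma compNr X Y Z (g : hom Y Z) (f : hom X Y) : g \oc (- f) = - (g \oc f).
Proof. by apply: (addrI (g \oc f)); rewrite -compDr !addrN comp0r. Qed.

Lemma is_iso_idm X : is_iso (idm X).
Proof. by exists (idm X); rewrite comp_idl. Qed.

Lemma isomorphic_refl X : isomorphic X X.
Proof. by exists (idm X); apply: is_iso_idm. Qed.

Lemma isomorphic_sym X Y : isomorphic X Y -> isomorphic Y X.
Proof. by case=> f [g [gf fg]]; exists g, f. Qed.

Lemma isomorphic_trans Y X Z :
  isomorphic X Y -> isomorphic Y Z -> isomorphic X Z.
Proof.
case=> f [f' [f'f ff']] [g [g' [g'g gg']]]; exists (g \oc f), (f' \oc g').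
split; first by rewrite -compA (compA g') g'g comp_idl.
by rewrite -compA (compA f) ff' comp_idl.
Qed.

Lemma iso_monic X Y Z (f : hom Y Z) (a b : hom X Y) :
  is_iso f -> f \oc a = f \oc b -> a = b.
Proof.
by case=> g [gf _] e; rewrite -[a]comp_idl -[b]comp_idl -gf -!compA e.
Qed.

Lemma iso_epic X Y Z (f : hom X Y) (a b : hom Y Z) :
  is_iso f -> a \oc f = b \oc f -> a = b.
Proof.
by case=> g [_ fg] e; rewrite -[a]comp_idr -[b]comp_idr -fg !compA e.
Qed.

Lemma hom_zero_iso X X' Y Y' :
  isomorphic X X' -> isomorphic Y Y' -> hom_zero X Y -> hom_zero X' Y'.
Proof.
case=> f f_iso [g g_iso] XY0 a.
case: (g_iso) => g' [g'g gg'].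
apply: (iso_epic f_iso); rewrite comp0l.
by rewrite -[_ \oc f]comp_idl -gg' -compA (XY0 (g' \oc _)) comp0r.
Qed.

Lemma zero_from O X : is_zero O -> hom_zero O X.
Proof. by move=> O0 f; rewrite -[f]comp_idr O0 comp0r. Qed.

Lemma zero_to O X : is_zero O -> hom_zero X O.
Proof. by move=> O0 f; rewrite -[f]comp_idl O0 comp0l. Qed.

Lemma direct_summandP X Y (s : hom X Y) (r : hom Y X) Z (i : hom Z Y)
    (p : hom Y Z) :
  r \oc s = idm X -> p \oc i = idm Z -> r \oc i = 0 -> p \oc s = 0 ->
  s \oc r + i \oc p = idm Y -> direct_summand X Y.
Proof.
move=> rs pi ri ps e; exists Z.
exists (fun b : bool => if b return hom (if b then X else Z) Y then s else i).
exists (fun b : bool => if b return hom Y (if b then X else Z) then r else p).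
split; first by case.
  by case; case.
by rewrite big_bool.
Qed.

Lemma subcategory_summand (A : full_subcat C) X Y :
  subcategory A -> A Y -> direct_summand X Y -> A X.
Proof.
move=> A_sub AY XY; apply/A_sub; exists 1%N, (fun=> Y), Y; split=> //.
exists (fun=> idm Y), (fun=> idm Y); split=> [i|i j|].
- by rewrite comp_idl.
- by rewrite !ord1.
- by rewrite big_ord1 comp_idl.
Qed.

End Preadditive.

Section AdditiveFunctor.
Variables (C D : preadditive) (F : additive_functor C D).

Lemma fmap0 X Y : fmap F (0 : hom X Y) = 0.
Proof. by apply: (addrI (fmap F 0)); rewrite -fmapD !addr0. Qed.

Lemma fmapN X Y (f : hom X Y) : fmap F (- f) = - fmap F f.
Proof. by apply: (addrI (fmap F f)); rewrite -fmapD !addrN fmap0. Qed.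

Lemma fmap_isomorphic X Y : isomorphic X Y -> isomorphic (F X) (F Y).
Proof.
case=> f [g [gf fg]]; exists (fmap F f), (fmap F g).
by rewrite -!fmap_comp gf fg !fmap_id.
Qed.

End AdditiveFunctor.

Lemma zero_object (D : additive_cat) : exists O : D, is_zero O.
Proof.
have F : 'I_0 -> D by case.
have [O [i [p [_ _ e]]]] := has_direct_sums F.
by exists O; rewrite /is_zero -e big_ord0.
Qed.

Lemma direct_summand_refl (D : additive_cat) (X : D) : direct_summand X X.
Proof.
have [O O0] := zero_object D.
apply: (@direct_summandP D X X (idm X) (idm X) O 0 0).
all: by rewrite ?comp_idl ?comp_idr ?comp0l ?comp0r ?addr0.
Qed.

Lemma subcategory_zero (D : additive_cat) (A : full_subcat D) (O : D) :
  subcategory A -> is_zero O -> A O.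
Proof.
move=> A_sub O0; apply/A_sub.
have sum0 (F : 'I_0 -> D) : is_direct_sum F O.
  have h (i : 'I_0) : False by case: i.
  exists (fun i => False_rect _ (h i)), (fun i => False_rect _ (h i)).
  by split=> [[]|[]|] //; rewrite big_ord0 O0.
exists 0%N, (fun=> O), O; split=> //; first by case.
exact: direct_summand_refl.
Qed.

(** The biproduct identities for two objects are repackaged as a sum indexed by ['I_2], the shape
    that [add_closure] asks for. *)
Lemma subcategory_sum (D : additive_cat) (A : full_subcat D) (X Y Z : D)
    (s : hom X Y) (r : hom Y X) (i : hom Z Y) (p : hom Y Z) :
  subcategory A -> A X -> A Z ->
  r \oc s = idm X -> p \oc i = idm Z -> r \oc i = 0 -> p \oc s = 0 ->
  s \oc r + i \oc p = idm Y -> A Y.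
Proof.
move=> A_sub AX AZ rs pi ri ps e; apply/A_sub.
pose sel (k : 'I_2) := if k == ord0 then X else Z.
exists 2%N, sel, Y; split; last exact: direct_summand_refl.
  by move=> k; rewrite /sel; case: ifP.
exists (fun k => if k == ord0 as b return hom (if b then X else Z) Y
  then s else i).
exists (fun k => if k == ord0 as b return hom Y (if b then X else Z)
  then r else p).
split=> [k|j k|].
- by rewrite /sel; case: (k == ord0).
- case: j => -[|[|//]] ltj; case: k => -[|[|//]] ltk //= _.
- by rewrite big_ord_recl big_ord1 /sel /=.
Qed.

(** * The shift as an autoequivalence *)

Section Shift.
Variable D : triangulated.
Implicit Types X Y Z W : D.

Lemma unshift_faithful X Y (f g : hom X Y) :
  fmap unshift f = fmap unshift g -> f = g.
Proof.
move=> e; apply: (iso_epic (shift_counit_iso X)).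
by rewrite !shift_counit_nat e.
Qed.

Lemma shift_faithful X Y (f g : hom X Y) :
  fmap shift f = fmap shift g -> f = g.
Proof.
move=> e; apply: (iso_monic (shift_unit_iso Y)).
by rewrite !shift_unit_nat e.
Qed.

Lemma shift_full X Y (g : hom (shift X) (shift Y)) :
  exists f : hom X Y, g = fmap shift f.
Proof.
have [v [vu uv]] := shift_unit_iso Y.
(* The preimage is $g$ carried back by the quasi-inverse and conjugated by the unit. *)
exists (v \oc (fmap unshift g \oc shift_unit X)).
apply: unshift_faithful; apply: (iso_epic (shift_unit_iso X)).
by rewrite -shift_unit_nat compA uv comp_idl.
Qed.

Lemma hom_zero_shift X Y : hom_zero (shift X) (shift Y) <-> hom_zero X Y.
Proof.
split=> h f.
  by apply: shift_faithful; rewrite (h (fmap shift f)) fmap0.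
by have [g ->] := shift_full f; rewrite (h g) fmap0.
Qed.

Lemma hom_zero_unshift X Y : hom_zero X (unshift Y) <-> hom_zero (shift X) Y.
Proof.
split=> h f.
  apply: unshift_faithful; apply: (iso_epic (shift_unit_iso X)).
  by rewrite (h (_ \oc _)) fmap0 comp0l.
apply: shift_faithful; apply: (iso_monic (shift_counit_iso Y)).
by rewrite (h (_ \oc _)) fmap0 comp0r.
Qed.

Lemma hom_zero_iter_shift n X Y :
  hom_zero (iter n shift X) (iter n shift Y) <-> hom_zero X Y.
Proof. by elim: n => //= n IHn; rewrite hom_zero_shift. Qed.

Lemma hom_zero_iter_unshift n X Y :
  hom_zero X (iter n unshift Y) <-> hom_zero (iter n shift X) Y.
Proof.
by elim: n X => //= n IHn X; rewrite hom_zero_unshift IHn -iterSr.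
Qed.

Lemma iter_fmap_isomorphic n X Y :
  isomorphic X Y -> isomorphic (iter n shift X) (iter n shift Y).
Proof. by elim: n => //= n IHn h; apply/fmap_isomorphic/IHn. Qed.

Lemma shift_unshift_iso X : isomorphic X (shift (unshift X)).
Proof.
by apply: isomorphic_sym; exists (shift_counit X); apply: shift_counit_iso.
Qed.

Lemma iter_shift_unshift n X :
  isomorphic X (iter n shift (iter n unshift X)).
Proof.
elim: n => [|n IHn]; first exact: isomorphic_refl.
rewrite iterSr iterS; apply: isomorphic_trans IHn _.
exact/iter_fmap_isomorphic/shift_unshift_iso.
Qed.

End Shift.

(** * Consequences of the triangulated axioms *)

Section Triangles.
Variable D : triangulated.
Implicit Types X Y Z W A B O : D.

Lemma dist_zero_id O X : is_zero O ->
  dist (0 : hom O X) (idm X) (0 : hom X (shift O)).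
Proof.
move=> O0; apply/dist_rotate; rewrite fmap0 oppr0; apply: dist_id.
by rewrite /is_zero -fmap_id O0 fmap0.
Qed.

Section Exactness.
Variables (X Y Z : D) (f : hom X Y) (g : hom Y Z) (h : hom Z (shift X)).
Hypothesis fgh : dist f g h.

Lemma dist_comp0 : g \oc f = 0.
Proof.
have [O O0] := zero_object D.
have [//|c [e _]] := dist_morphism (a := idm X) (b := f) (dist_id X O0) fgh.
by rewrite -e comp0r.
Qed.

(** The map $a$ starts a morphism from the rotation of $W = W \to 0$ to that of the given triangle;
    its third component is $-b[1]$ up to sign, and the shift is full and faithful. *)
Lemma dist_lift W (a : hom W Y) : g \oc a = 0 -> exists b, a = f \oc b.
Proof.
move=> ga0; have [O O0] := zero_object D.
have /dist_rotate WO := dist_id W O0.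
have /dist_rotate gh := fgh.
have [|c [_]] := dist_morphism (a := a) (b := 0 : hom O Z) WO gh.
  by rewrite ga0 comp0l.
have [b ->] := shift_full c.
rewrite fmap_id compNr comp_idr compNl -fmap_comp => /oppr_inj/shift_faithful.
by exists b.
Qed.

Lemma dist_extend W (a : hom Y W) : a \oc f = 0 -> exists b, a = b \oc g.
Proof.
move=> af0; have [O O0] := zero_object D.
have [|c [e _]] := dist_morphism (a := 0 : hom X O) (b := a) fgh
  (dist_zero_id W O0).
  by rewrite af0 comp0l.
by exists c; rewrite e comp_idl.
Qed.

End Exactness.

Lemma dist_lift_cone X Y Z (f : hom X Y) (g : hom Y Z) (h : hom Z (shift X)) W
    (a : hom W Z) :
  dist f g h -> h \oc a = 0 -> exists b, a = g \oc b.
Proof. by move=> /dist_rotate gh; apply: (dist_lift gh). Qed.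

Lemma dist_extend_source X Y Z (f : hom X Y) (g : hom Y Z)
    (h : hom Z (shift X)) W (a : hom X W) :
  dist f g h -> fmap shift a \oc h = 0 -> exists b, a = b \oc f.
Proof.
move=> /dist_rotate/dist_rotate hfg /(dist_extend hfg)[c].
have [b ->] := shift_full c.
rewrite compNr -fmap_comp -fmapN => /shift_faithful ->.
by exists (- b); rewrite compNl.
Qed.

(** Complete $g$ to a cone $C$ and rotate back, with $X = C[-1]$; since $C[-1][1]$ is only
    isomorphic to $C$, the third map is corrected by the counit. *)
Lemma dist_cocone Y Z (g : hom Y Z) :
  exists X (f : hom X Y) (h : hom Z (shift X)), dist f g h.
Proof.
have [C [v [v' gv]]] := dist_complete g.
have [c c_iso] := shift_unshift_iso C; have [c' [c'c _]] := c_iso.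
have [f f_eq] := shift_full (v' \oc c').
exists (unshift C), (- f), (c \oc v).
apply/dist_rotate; rewrite fmapN opprK -f_eq.
apply: dist_iso (is_iso_idm Y) (is_iso_idm Z) c_iso _ _ _ gv.
- by rewrite comp_idl comp_idr.
- by rewrite comp_idr.
- by rewrite fmap_id comp_idl -compA c'c comp_idr.
Qed.

(** Only the vertices are recorded, which suffices for vanishing and membership arguments and makes
    rotation free of signs. *)
Definition triangle X Y Z : Prop :=
  exists (f : hom X Y) (g : hom Y Z) (h : hom Z (shift X)), dist f g h.

Lemma triangle_rotate X Y Z : triangle X Y Z <-> triangle Y Z (shift X).
Proof.
split=> [[f [g [h /dist_rotate fgh]]]|[f [g [h fgh]]]].
  by do 3 eexists; eassumption.
have [k hk] := shift_full h.
by exists (- k), f, g; apply/dist_rotate; rewrite fmapN opprK -hk.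
Qed.

Lemma triangle_shift X Y Z :
  triangle (shift X) (shift Y) (shift Z) <-> triangle X Y Z.
Proof. by rewrite -!triangle_rotate. Qed.

Lemma triangle_iter_shift n X Y Z :
  triangle X Y Z ->
  triangle (iter n shift X) (iter n shift Y) (iter n shift Z).
Proof. by elim: n => //= n IHn h; apply/triangle_shift/IHn. Qed.

Lemma triangle_iso X Y Z X' Y' Z' :
  isomorphic X X' -> isomorphic Y Y' -> isomorphic Z Z' ->
  triangle X Y Z -> triangle X' Y' Z'.
Proof.
move=> [a a_iso] [b b_iso] [c c_iso] [f [g [h fgh]]].
have [a' [a'a aa']] := a_iso; have [b' [b'b bb']] := b_iso.
have [c' [c'c cc']] := c_iso.
exists (b \oc f \oc a'), (c \oc g \oc b'), (fmap shift a \oc h \oc c').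
apply: (dist_iso (a := a) (b := b) (c := c)) fgh => //.
- by rewrite -compA a'a comp_idr.
- by rewrite -compA b'b comp_idr.
- by rewrite -compA c'c comp_idr.
Qed.

Lemma triangle_zero_left O X : is_zero O -> triangle O X X.
Proof. by move=> O0; do 3 eexists; apply: dist_zero_id. Qed.

Lemma triangle_zero_right O X : is_zero O -> triangle X X O.
Proof. by move=> O0; do 3 eexists; apply: dist_id. Qed.

Lemma triangle_zero_iso X Y O : is_zero O -> triangle X Y O -> isomorphic X Y.
Proof.
move=> O0 [f [g [h fgh]]]; exists f.
have [|b b_eq] := dist_lift fgh (a := idm Y); first exact: zero_to.
have [|c c_eq] := dist_extend_source (a := idm X) fgh; first exact: zero_from.
exists c; split=> //; rewrite [RHS]b_eq; congr (f \oc _).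
by rewrite -[b]comp_idl c_eq -compA -b_eq comp_idr.
Qed.

Lemma dist_octahedron X Y Z A B C (f : hom X Y) (u : hom Y A)
    (u' : hom A (shift X)) (g : hom Y Z) (v : hom Z B) (v' : hom B (shift Y))
    (w : hom Z C) (w' : hom C (shift X)) :
  dist f u u' -> dist g v v' -> dist (g \oc f) w w' -> triangle A C B.
Proof.
move=> fA gB gfC; have [a [b [ab _]]] := dist_octahedral fA gB gfC.
by do 3 eexists; eassumption.
Qed.

Lemma triangle_octahedron X Y Z A B :
  triangle X Y Z -> triangle Y A B ->
  exists C, triangle X A C /\ triangle Z C B.
Proof.
move=> [f [u [u' fu]]] [g [v [v' gv]]].
have [C [w [w' gf]]] := dist_complete (g \oc f).
exists C; split; first by do 3 eexists; eassumption.
exact: dist_octahedron fu gv gf.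
Qed.

(** The octahedron on $N \to B \to C$; $W$ is the cocone of the composite. *)
Lemma triangle_compose B1 N B A C :
  triangle B1 N B -> triangle A B C ->
  exists W, triangle W N C /\ triangle B1 W A.
Proof.
move=> /triangle_rotate t1 /triangle_rotate t2.
have [K [NCK BKA]] := triangle_octahedron t1 t2.
have iK := shift_unshift_iso K.
exists (unshift K); split.
  apply/triangle_rotate.
  by apply: triangle_iso NCK => //; apply: isomorphic_refl.
by apply/triangle_shift; apply: triangle_iso BKA => //; apply: isomorphic_refl.
Qed.

(** $U$ is the homotopy pullback of $W \to A \leftarrow N$, obtained from the octahedron on $W \to A
    \to A_1[1]$. *)
Lemma triangle_pullback B1 W A A1 N :
  triangle B1 W A -> triangle A1 N A ->
  exists U, triangle A1 U W /\ triangle B1 U N.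
Proof.
move=> /triangle_rotate t1 /triangle_rotate/triangle_rotate t2.
have [K [WAK BKN]] := triangle_octahedron t1 t2.
have iK := shift_unshift_iso K.
exists (unshift K); split.
  apply/triangle_rotate/triangle_rotate.
  by apply: triangle_iso WAK => //; apply: isomorphic_refl.
by apply/triangle_shift; apply: triangle_iso BKN => //; apply: isomorphic_refl.
Qed.

(** The connecting map N -> B1[1] vanishes, so B1 -> B2[1] extends to U; V is the
    cocone of the extension. *)
Lemma triangle_lift_extension B1 U N B2 N' :
  hom_zero N (shift B1) -> triangle B1 U N -> triangle B2 N' B1 ->
  exists V, triangle B2 V U /\ triangle N' V N.
Proof.
move=> NB0 [f [g [h fgh]]] /triangle_rotate/triangle_rotate[b [v [v' bv]]].
have [|c c_eq] := dist_extend_source (a := b) fgh.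
  by rewrite (NB0 h) comp0r.
have [K [w [w' cw]]] := dist_complete c.
have NNK : triangle N (shift N') K.
  by move: bv; rewrite c_eq => bv; apply: dist_octahedron fgh cw bv.
have iK := shift_unshift_iso K.
exists (unshift K); split.
  apply/triangle_rotate/triangle_rotate.
  apply: triangle_iso (isomorphic_refl _) (isomorphic_refl _) iK _.
  by do 3 eexists; eassumption.
apply/triangle_rotate/triangle_rotate.
exact: triangle_iso (isomorphic_refl _) (isomorphic_refl _) iK NNK.
Qed.

(** * Vanishing of Hom along a triangle, and splitting *)

Section HomZero.
Variables (X Y Z W : D).
Hypothesis XYZ : triangle X Y Z.

Lemma hom_zero_to_middle : hom_zero W X -> hom_zero W Z -> hom_zero W Y.
Proof.
case: XYZ => f [g [h fgh]] WX WZ a.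
have [|b ->] := dist_lift fgh (a := a); first exact: WZ.
by rewrite (WX b) comp0r.
Qed.

Lemma hom_zero_from_middle : hom_zero X W -> hom_zero Z W -> hom_zero Y W.
Proof.
case: XYZ => f [g [h fgh]] XW ZW a.
have [|b ->] := dist_extend fgh (a := a); first exact: XW.
by rewrite (ZW b) comp0l.
Qed.

Lemma hom_zero_from_source :
  hom_zero Y W -> hom_zero Z (shift W) -> hom_zero X W.
Proof.
case: XYZ => f [g [h fgh]] YW ZW a.
have [|b ->] := dist_extend_source (a := a) fgh; first exact: ZW.
by rewrite (YW b) comp0l.
Qed.

End HomZero.

Lemma hom_zero_to_cone W X Y Z :
  triangle X Y Z -> hom_zero W Y -> hom_zero W (shift X) -> hom_zero W Z.
Proof. by move=> /triangle_rotate; apply: hom_zero_to_middle. Qed.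

Lemma hom_zero_to_source_shift W X Y Z :
  triangle X Y Z -> hom_zero W Z -> hom_zero W (shift Y) ->
  hom_zero W (shift X).
Proof.
by move=> /triangle_rotate/triangle_rotate; apply: hom_zero_to_middle.
Qed.

Lemma hom_zero_from_cone_shift X Y Z W :
  triangle X Y Z -> hom_zero X W -> hom_zero Y (shift W) ->
  hom_zero Z (shift W).
Proof.
move=> /triangle_rotate t XW YW; apply: hom_zero_from_middle t YW _.
exact/hom_zero_shift.
Qed.

Lemma hom_zero_lift X Y Z (f : hom X Y) (g : hom Y Z) (h : hom Z (shift X)) W :
  dist f g h -> (forall a : hom W Z, exists b, a = g \oc b) ->
  hom_zero W (shift Y) -> hom_zero W (shift X).
Proof.
move=> fgh W_lift WY e.
have /dist_rotate gh := fgh; have /dist_rotate hf := gh.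
have [|a ->] := dist_lift hf (a := e); first exact: WY.
by have [b ->] := W_lift a; rewrite compA (dist_comp0 gh) comp0l.
Qed.

Lemma triangle_split X Y Z : triangle X Y Z -> hom_zero Z (shift X) ->
  exists (f : hom X Y) (r : hom Y X) (s : hom Z Y) (g : hom Y Z),
  [/\ r \oc f = idm X, g \oc s = idm Z, r \oc s = 0, g \oc f = 0
    & f \oc r + s \oc g = idm Y] /\ exists h, dist f g h.
Proof.
move=> [f [g [h fgh]]] ZX.
have [|r rf] := dist_extend_source (a := idm X) fgh.
  by rewrite (ZX h) comp0r.
have [|t gt] := dist_lift_cone (a := idm Z) fgh.
  by rewrite (ZX h) comp0l.
have gf := dist_comp0 fgh.
(* The section $t$ of $g$ is corrected so that it is also killed by $r$. *)
pose s := t - f \oc r \oc t.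
have gs : g \oc s = idm Z by rewrite compDr compNr !compA gf !comp0l subr0.
have rs : r \oc s = 0.
  by rewrite compDr compNr !compA -rf comp_idl addrN.
exists f, r, s, g; split; last by exists h.
split=> //.
(* The defect of the decomposition of the identity kills $f$, so it is $e \circ g$; composing with
   $s$ shows $e = 0$. *)
have [|e ee] := dist_extend fgh (a := idm Y - (f \oc r + s \oc g)).
  rewrite compDl compNl compDl -!compA gf -rf comp0r comp_idr comp_idl.
  by rewrite addr0 addrN.
have e0 : e = 0.
  rewrite -[e]comp_idr -gs compA -ee compDl compNl compDl -!compA gs rs.
  by rewrite comp0r comp_idr comp_idl add0r addrN.
by move: ee; rewrite e0 comp0l => /subr0_eq.
Qed.

Lemma triangle_split_summand X Y Z :
  triangle X Y Z -> hom_zero Z (shift X) -> direct_summand Z Y.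
Proof.
move=> t ZX; have [f [r [s [g [[rf gs rs gf e] _]]]]] := triangle_split t ZX.
by apply: (direct_summandP gs rf gf rs); rewrite addrC.
Qed.

Lemma subcategory_split (A : full_subcat D) X Y Z :
  subcategory A -> triangle X Y Z -> hom_zero Z (shift X) -> A X -> A Z -> A Y.
Proof.
move=> A_sub t ZX AX AZ.
have [f [r [s [g [[rf gs rs gf e] _]]]]] := triangle_split t ZX.
exact: subcategory_sum A_sub AX AZ rf gs rs gf e.
Qed.

Lemma triangle_split_swap X Y Z :
  triangle X Y Z -> hom_zero Z (shift X) -> triangle Z Y X.
Proof.
move=> t ZX.
have [f [r [s [g [[_ gs _ _ _] [h /dist_rotate gh]]]]]] := triangle_split t ZX.
have [K [v [v' sv]]] := dist_complete s.
have [O O0] := zero_object D.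
(* The composite $g \circ s$ is the identity, with zero cone, so the octahedron identifies the cone
   $K$ of $s$ with $X$. *)
have KX : triangle K O (shift X).
  by apply: dist_octahedron sv gh _; rewrite gs; apply: dist_id.
have /(triangle_zero_iso O0)/isomorphic_sym iK : triangle X K O.
  exact/triangle_rotate.
apply: triangle_iso (isomorphic_refl _) (isomorphic_refl _) iK _.
by do 3 eexists; eassumption.
Qed.

End Triangles.

(** * Closure properties of the extended heart *)

Section Heart.
Variables (D : triangulated) (P : full_subcat D) (d : nat).
Hypothesis d_gt0 : (0 < d)%N.
Implicit Types X Y Z Q O : D.

(** Negative shifts of $Y$ are moved to positive shifts of $Q$, so that afterwards only iterates of
    [shift] occur. *)
Lemma extended_heartP Y : extended_heart P d Y <->
  forall Q, P Q ->
    (forall n, (0 < n)%N -> hom_zero Q (iter n shift Y)) /\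
    (forall n, (d <= n)%N -> hom_zero (iter n shift Q) Y).
Proof.
have d_eq : - (- d%:Z + 1) = d.-1%:Z by lia.
rewrite /extended_heart /Dinterval /Dle /Dge d_eq oppr0.
split=> [[[Z [Z_le YZ]] [W [W_ge YW]]] Q PQ|h].
  split=> [n n_gt0|n le_dn].
    apply: hom_zero_iso (isomorphic_refl _) _ (Z_le n _ Q PQ).
      exact/iter_fmap_isomorphic/isomorphic_sym.
    by rewrite ltz_nat.
  apply: hom_zero_iso (isomorphic_refl _) (isomorphic_sym YW) _.
  (* $Y$ is $W[d-1]$: the first $d-1$ shifts cancel, and the remaining $n-d+1 > 0$ give a negative
     degree for $W$. *)
  have -> : n = (d.-1 + (n - d).+1)%N by lia.
  rewrite iterD; apply/hom_zero_iter_shift/hom_zero_iter_unshift.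
  by apply: (W_ge (Negz (n - d))).
split.
  exists Y; split; last exact: isomorphic_refl.
  by case=> // n n_gt0 Q /h[+ _]; apply.
exists (iter d.-1 unshift Y); split; last exact: iter_shift_unshift.
case=> // n _ Q /h[_ Q_neg]; rewrite /shiftn -iterD.
by apply/hom_zero_iter_unshift/Q_neg; lia.
Qed.

Lemma extended_heart_projective Q Y n :
  P Q -> extended_heart P d Y -> (0 < n)%N -> hom_zero Q (iter n shift Y).
Proof. by move=> PQ /extended_heartP/(_ Q PQ)[+ _]; apply. Qed.

Lemma extended_heart_extension X Y Z :
  triangle X Y Z -> extended_heart P d X -> extended_heart P d Z ->
  extended_heart P d Y.
Proof.
move=> t /extended_heartP hX /extended_heartP hZ.
apply/extended_heartP => Q PQ.
have [X_pos X_neg] := hX Q PQ; have [Z_pos Z_neg] := hZ Q PQ.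
split=> n hn.
  apply: hom_zero_to_middle (triangle_iter_shift n t) _ _; first exact: X_pos.
  exact: Z_pos.
by apply: hom_zero_to_middle t _ _; [apply: X_neg | apply: Z_neg].
Qed.

Lemma extended_heart_zero O : is_zero O -> extended_heart P d O.
Proof.
move=> O0; apply/extended_heartP => Q PQ; split=> n _; last exact: zero_to.
apply: zero_to; elim: n => //= n IHn.
by rewrite /is_zero -fmap_id IHn fmap0.
Qed.

Lemma extended_heart_source X Y Z (f : hom X Y) (g : hom Y Z)
    (h : hom Z (shift X)) :
  dist f g h -> extended_heart P d Y -> extended_heart P d Z ->
  (forall Q, P Q -> forall a : hom Q Z, exists b, a = g \oc b) ->
  extended_heart P d X.
Proof.
move=> fgh /extended_heartP hY /extended_heartP hZ P_lift.
have t : triangle X Y Z by exists f, g, h.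
apply/extended_heartP => Q PQ.
have [Y_pos Y_neg] := hY Q PQ; have [Z_pos Z_neg] := hZ Q PQ.
split=> n hn.
  (* Degree 1 is where the lifting of maps from $\mathcal{P}$ enters; higher degrees follow from the
     long exact sequence. *)
  case: n hn => // -[_|n _].
    by apply: hom_zero_lift fgh _ _; [apply: P_lift | apply: (Y_pos 1%N)].
  apply: hom_zero_to_source_shift (triangle_iter_shift n.+1 t) _ _.
    exact: Z_pos.
  exact: (Y_pos n.+2).
apply/hom_zero_shift; apply: hom_zero_to_source_shift t _ _.
  exact: (Z_neg n.+1 (leqW hn)).
exact/hom_zero_shift/Y_neg.
Qed.

(** The syzygy is the cocone of a right $\mathcal{P}$-approximation; it stays in the heart because
    maps from $\mathcal{P}$ lift along the approximation. *)
Lemma extended_heart_enough_projectives :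
  contravariantly_finite P (fun _ : D => True) ->
  subcat_incl P (extended_heart P d) ->
  forall Y, extended_heart P d Y ->
    exists Z Q, P Q /\ extriangle (extended_heart P d) Z Q Y.
Proof.
move=> P_cf PH Y HY; have [//|Q [g [PQ g_approx]]] := P_cf Y.
have [Z [f [h fgh]]] := dist_cocone g.
exists Z, Q; split=> //; exists f, g, h; split=> //; last exact: PH.
apply: extended_heart_source fgh _ HY _; first exact: PH.
by move=> Q' PQ' a; apply: g_approx.
Qed.

End Heart.

(** * Recursive forms of the resolutions in the definitions *)

Section Resolutions.
Variables (D : triangulated) (H : full_subcat D).
Hypothesis H_zero : forall O, is_zero O -> H O.
Implicit Types (M : full_subcat D) (X Y Z O : D).

Lemma extriangleP X Y Z :
  extriangle H X Y Z <-> [/\ H X, H Y, H Z & triangle X Y Z].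
Proof.
split=> [[f [g [h [HX HY HZ fgh]]]]|[HX HY HZ [f [g [h fgh]]]]].
  by split=> //; exists f, g, h.
by exists f, g, h; split.
Qed.

Lemma Fac0 M Y : Fac H 0 M Y <-> H Y.
Proof.
split=> [[]//|HY]; split=> //; exists (fun=> Y), (fun=> Y).
by split=> // i; case: i.
Qed.

(** Splitting off the extriangle that ends in $Y$ allows induction on $s$. *)
Lemma FacS M s Y : Fac H s.+1 M Y <->
  exists Z N, [/\ M N, extriangle H Z N Y & Fac H s M Z].
Proof.
split=> [[HY [Z [N [<- ZN]]]]|[Z0 [N0 [MN0 t [HZ [Z [N [Z_eq ZN]]]]]]]].
  have [//|MN t] := ZN 1%N; exists (Z 1%N), (N 1%N); split=> //.
  have [HZ _ _ _] := (extriangleP _ _ _).1 t.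
  split=> //; exists (fun i => Z i.+1), (fun i => N i.+1); split=> //.
  by case=> // i le_is; apply: (ZN i.+2).
have [_ _ HY _] := (extriangleP _ _ _).1 t.
split=> //; exists (fun i => if i is j.+1 then Z j else Y).
exists (fun i => if i is j.+1 then if j is 0 then N0 else N j else N0).
split=> //; case=> // -[_|i lt_is]; first by rewrite Z_eq.
exact: (ZN i.+1).
Qed.

Lemma FacW M s Y : Fac H s.+1 M Y -> Fac H s M Y.
Proof.
elim: s Y => [|s IHs] Y; first by case=> HY _; apply/Fac0.
by move=> /FacS[Z [N [MN t /IHs FZ]]]; apply/FacS; exists Z, N.
Qed.

Lemma Fac_heart M s Y : Fac H s M Y -> H Y.
Proof. by case. Qed.

Fixpoint resolved (P : full_subcat D) n Y : Prop :=
  if n is m.+1 then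
    exists Z Q, [/\ P Q, extriangle H Z Q Y & resolved P m Z]
  else P Y.

Lemma resolvedP (P : full_subcat D) n Y :
  subcategory P -> subcat_incl P H -> projdim_le H P n Y <-> resolved P n Y.
Proof.
move=> P_sub PH; split.
  case=> Z [Q [<- ZQ]].
  elim: n Z Q ZQ => //= n IHn Z Q ZQ PZ.
  have [//|PQ t] := ZQ 1%N; exists (Z 1%N), (Q 0%N); split=> //.
  apply: (IHn (fun i => Z i.+1) (fun i => Q i.+1)) => //.
  by case=> // i _; apply: (ZQ i.+2).
have [O O0] := zero_object D; have HO := H_zero O0.
have PO := subcategory_zero P_sub O0.
elim: n Y => [|n IHn] Y /=.
  (* The infinite resolution is padded by zeros: $0 \to Y \to Y$, then $0 \to 0 \to 0$ forever. *)
  move=> PY; exists (fun i => if i is 0 then Y else O).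
  exists (fun i => if i is 0 then Y else O); split=> // -[//|[|i]] _ /=.
    split=> //; apply/extriangleP; split=> //; try exact: PH.
    exact: triangle_zero_left.
  by split=> //; apply/extriangleP; split=> //; apply: triangle_zero_left.
move=> [Z0 [Q0 [PQ0 t /IHn[Z [Q [Z_eq ZQ PZ]]]]]].
exists (fun i => if i is j.+1 then Z j else Y).
exists (fun i => if i is j.+1 then Q j else Q0).
split=> // -[//|[|i]] _ /=; first by rewrite Z_eq.
exact: (ZQ i.+1).
Qed.

Fixpoint coresolved M r Y : Prop :=
  if r is s.+1 then
    exists N Z, [/\ M N, extriangle H Y N Z & coresolved M s Z]
  else M Y.

Lemma coresolvedP M r Y : coresolved M r Y <->
  exists Z N : nat -> D, [/\ Z 0%N = Y,
    forall i, (1 <= i <= r)%N ->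
      M (N i.-1) /\ extriangle H (Z i.-1) (N i.-1) (Z i)
    & M (Z r)].
Proof.
elim: r Y => [|r IHr] Y /=.
  split=> [MY|[Z [N [<- _]]]//]; exists (fun=> Y), (fun=> Y).
  by split=> // -[].
split=> [[N0 [Z0 [MN0 t /IHr[Z [N [Z_eq ZN MZ]]]]]]|[Z [N [<- ZN MZ]]]].
  exists (fun i => if i is j.+1 then Z j else Y).
  exists (fun i => if i is j.+1 then N j else N0).
  split=> // -[//|[|i]] le_ir /=; first by rewrite Z_eq.
  exact: (ZN i.+1).
have [//|MN t] := ZN 1%N; exists (N 0%N), (Z 1%N); split=> //.
apply/IHr; exists (fun i => Z i.+1), (fun i => N i.+1); split=> //.
by case=> // i le_ir; apply: (ZN i.+2).
Qed.

End Resolutions.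

(** * Dimension shifting in an extension-closed subcategory with enough projectives and
    injectives *)

Section Tilting.
Variables (D : triangulated) (H P M : full_subcat D) (d : nat).
Implicit Types (N Q W X Y Z I O : D).
Hypotheses (H_zero : forall O, is_zero O -> H O)
  (H_extension : forall X Y Z, triangle X Y Z -> H X -> H Z -> H Y)
  (H_source : forall X Y Z (f : hom X Y) (g : hom Y Z) (h : hom Z (shift X)),
     dist f g h -> H Y -> H Z ->
     (forall Q, P Q -> forall a : hom Q Z, exists b, a = g \oc b) -> H X)
  (P_sub : subcategory P) (PH : subcat_incl P H)
  (P_proj : forall Q Y n, P Q -> H Y -> (0 < n)%N ->
     hom_zero Q (iter n shift Y))
  (enough_proj : forall Y, H Y ->
     exists Z Q, P Q /\ extriangle H Z Q Y)
  (enough_inj : enough_injectives H)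
  (M_sub : subcategory M) (MH : subcat_incl M H).

Lemma projective_dimension_vanishing n k Y X :
  resolved H P n Y -> H X -> (n < k)%N -> hom_zero Y (iter k shift X).
Proof.
move=> + HX; elim: n k Y => [|n IHn] k Y /=; first by move=> PY; apply: P_proj.
case=> Z [Q [PQ /extriangleP[HZ HQ HY t] /IHn Z_res]]; case: k => // k lt_nk.
apply: hom_zero_from_cone_shift t (Z_res _ lt_nk) _.
exact: (P_proj (n := k.+1)).
Qed.

(** Vanishing passes to the syzygy with the degree lowered by one; at $n = 0$ the extriangle $Z \to
    Q \to Y$ splits, so $Y$ is a summand of $Q$. *)
Lemma resolved_vanishing n Y :
  H Y -> (forall X, H X -> hom_zero Y (iter n.+1 shift X)) -> resolved H P n Y.
Proof.
elim: n Y => [|n IHn] Y HY Y_van /=; have [Z [Q [PQ e]]] := enough_proj HY.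
  have [HZ _ _ t] := (extriangleP _ _ _ _).1 e.
  exact: subcategory_summand P_sub PQ (triangle_split_summand t (Y_van _ HZ)).
have [HZ HQ _ t] := (extriangleP _ _ _ _).1 e.
exists Z, Q; split=> //; apply: IHn => // X HX.
apply: hom_zero_from_source t _ (Y_van _ HX).
exact: (P_proj (n := n.+1)).
Qed.

(** Shifting along projective syzygies of $Y$ reduces every degree to $\mathbb{E}^1$. *)
Lemma injective_vanishing n Y I :
  E_injective H I -> H Y -> (0 < n)%N -> hom_zero Y (iter n shift I).
Proof.
move=> [HI I_inj]; case: n => // n + _; elim: n Y => [|n IHn] Y HY.
  exact: (I_inj Y HY).
have [Z [Q [PQ /extriangleP[HZ _ _ t]]]] := enough_proj HY.
apply: hom_zero_from_cone_shift t (IHn _ HZ) _.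
exact: (P_proj (n := n.+2)).
Qed.

Lemma M_zero O : is_zero O -> M O.
Proof. exact: subcategory_zero. Qed.

Lemma M_sub_Fac s N : M N -> Fac H s M N.
Proof.
have [O O0] := zero_object D; have HO := H_zero O0; have MO := M_zero O0.
elim: s N => [|s IHs] N MN; first by apply/Fac0/MH.
apply/FacS; exists O, N; split=> //; last exact: IHs.
apply/extriangleP; split=> //; try exact: MH.
exact: triangle_zero_left.
Qed.

(** $\mathbb{E}^n(S,X)$ lies between $\mathbb{E}^n(N,X)$ and $\mathbb{E}^{n+1}(Z,X)$, so the
    induction on $r$ runs over all $n$ at once. *)
Lemma coresolved_vanishing r S X :
  coresolved H M r S -> T_class H M X ->
  forall n, (0 < n)%N -> hom_zero S (iter n shift X).
Proof.
move=> + [HX X_van]; elim: r S => [|r IHr] S /=.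
  by move=> MS n n_gt0; apply: X_van.
case=> N [Z [MN /extriangleP[_ _ _ t] Z_cores]] n n_gt0.
apply: hom_zero_from_source t _ _; first exact: X_van.
exact: (IHr _ Z_cores n.+1).
Qed.

(** * Resolving $\mathcal{T}(\mathcal{M})$ by $\mathcal{M}$-approximations *)

Section Approximation.
Hypotheses (M_cf : contravariantly_finite M H)
  (M_rigid : forall i, (0 < i)%N -> forall N N', M N -> M N' ->
     Ext_zero i N N').

Lemma T_class_approximation Y : T_class H M Y ->
  (forall Q, P Q -> forall a : hom Q Y,
     exists N (b : hom Q N) (c : hom N Y), M N /\ a = c \oc b) ->
  exists Z N, [/\ M N, extriangle H Z N Y & T_class H M Z].
Proof.
move=> [HY Y_van] Y_gen; have [N [g [MN g_approx]]] := M_cf HY.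
have [Z [f [h fgh]]] := dist_cocone g.
have HZ : H Z.
  (* A map from $\mathcal{P}$ factors through some object of $\mathcal{M}$, hence through the
     approximation $g$. *)
  apply: H_source fgh (MH MN) HY _ => Q PQ a.
  have [N' [b [c [MN' ->]]]] := Y_gen Q PQ a.
  by have [k ->] := g_approx N' c MN'; exists (k \oc b); rewrite compA.
have t : triangle Z N Y by exists f, g, h.
exists Z, N; split=> //; first by apply/extriangleP; split=> //; apply: MH.
split=> //; case=> // -[_|i _] N' MN'.
  apply: hom_zero_lift fgh _ _; first by move=> a; apply: g_approx.
  exact: (M_rigid (i := 1)).
apply: hom_zero_to_source_shift (triangle_iter_shift i.+1 t) _ _.
  exact: (Y_van i.+1).
exact: (M_rigid (i := i.+2)).
Qed.

Lemma T_class_sub_Fac :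
  (forall Y, T_class H M Y -> forall Q, P Q -> forall a : hom Q Y,
     exists N (b : hom Q N) (c : hom N Y), M N /\ a = c \oc b) ->
  forall s Y, T_class H M Y -> Fac H s M Y.
Proof.
move=> T_gen; elim=> [|s IHs] Y TY; first by apply/Fac0; case: TY.
have [Z [N [MN e TZ]]] := T_class_approximation TY (T_gen _ TY).
by apply/FacS; exists Z, N; split=> //; apply: IHs.
Qed.

End Approximation.

Lemma tilting_T_class : contravariantly_finite M H ->
  tilting H P d M -> subcat_eq (T_class H M) (Fac H d M).
Proof.
move=> M_cf [M_pd M_rigid M_cores] Y; split=> [TY|].
  apply: T_class_sub_Fac TY => // {}Y TY Q PQ a.
  have [[|r]] := M_cores Q PQ; move=> /coresolvedP/=.
    by move=> MQ; exists Q, (idm Q), a; rewrite comp_idr.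
  case=> N [Z [MN /extriangleP[_ _ _ [f [g [h fgh]]]] Z_cores]].
  (* The obstruction to extending $a$ along $Q \to N$ lies in $\mathbb{E}(Z,Y)$, which vanishes
     because $Z$ is coresolved by $\mathcal{M}$. *)
  have [|c ->] := dist_extend_source (a := a) fgh.
    by rewrite (coresolved_vanishing Z_cores TY (n := 1) isT (_ \oc _)).
  by exists N, f, c.
move=> FY; split=> [|i i_gt0 N MN]; first exact: Fac_heart FY.
have /(resolvedP H_zero _ _ P_sub PH) N_res := M_pd N MN.
have {}N_res X k : H X -> (d < k)%N -> hom_zero N (iter k shift X).
  exact: projective_dimension_vanishing.
(* Each step of an $\mathcal{M}$-resolution of $X$ trades for one degree of $\mathbb{E}$; $s = 0$ is
   the projective dimension bound, and $s = d$ covers all $j > 0$. *)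
suff van s : forall j X, (0 < j)%N -> (d < j + s)%N -> Fac H s M X ->
    hom_zero N (iter j shift X).
  by apply: van FY => //; rewrite -[X in (X < _)%N]add0n ltn_add2r.
elim: s => [|s IHs] j X j_gt0 lt_djs FX.
  by apply: N_res; [apply: Fac_heart FX | rewrite addn0 in lt_djs].
have /FacS[Z [N' [MN' /extriangleP[_ _ _ t] FZ]]] := FX.
apply: hom_zero_to_cone (triangle_iter_shift j t) _ _; first exact: M_rigid.
by apply: (IHs j.+1) => //; rewrite addSnnS.
Qed.

(** * Closure properties of $\operatorname{Fac}_d(\mathcal{M})$ and the passage from quasi-tilting
    to tilting *)

Section QuasiTilting.
Local Notation F := (Fac H d M).
Hypotheses (F_stable : forall Y, F Y -> Fac H d.+1 M Y)
  (F_rigid : forall N Y, M N -> F Y -> hom_zero N (shift Y)).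

Lemma F_resolve Y : F Y -> exists Z N, [/\ M N, triangle Z N Y & F Z].
Proof.
move=> /F_stable/FacS[Z [N [MN /extriangleP[_ _ _ t] FZ]]].
by exists Z, N.
Qed.

(** Lifting the extension along $N' \to B$ gives $B_2 \to V \to U$, where $V$ is an extension of $N$
    by $N'$; this splits, so $V$ lies in $\mathcal{M}$. *)
Lemma F_extension_by_M B U N : triangle B U N -> F B -> M N -> F U.
Proof.
move=> t FB MN; have [B2 [N' [MN' t' FB2]]] := F_resolve FB.
have HU : H U by apply: H_extension t (Fac_heart FB) (MH MN).
have [V [BVU NVN]] := triangle_lift_extension (F_rigid MN FB) t t'.
have MV : M V.
  exact: subcategory_split M_sub NVN (F_rigid MN (M_sub_Fac d MN')) MN' MN.
apply/FacW/FacS; exists B2, V; split=> //; apply/extriangleP; split=> //.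
  exact: Fac_heart FB2.
exact: MH.
Qed.

(** Resolving $B$ by $N$ gives $W \to N \to C$ with $W$ an extension of $A$ by $B_1 \in F$. Pulling
    back a resolution $A_1 \to N' \to A$ presents $W$ as the cone of $A_1 \to U$ with $U \in F$, and
    the induction applies. *)
Lemma F_cone s A B C :
  triangle A B C -> Fac H s M A -> F B -> H C -> Fac H s.+1 M C.
Proof.
elim: s A B C => [|s IHs] A B C t FA FB HC.
all: have [B1 [N [MN t1 FB1]]] := F_resolve FB.
all: have [W [WNC BWA]] := triangle_compose t1 t.
all: have HW : H W by apply: H_extension BWA (Fac_heart FB1) (Fac_heart FA).
all: apply/FacS; exists W, N; split=> //.
1,3: by apply/extriangleP; split=> //; apply: MH.
  exact/Fac0.
have /FacS[A1 [N' [MN' /extriangleP[_ _ _ t2] FA1]]] := FA.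
have [U [AUW BUN]] := triangle_pullback BWA t2.
exact: IHs AUW FA1 (F_extension_by_M BUN FB1 MN') HW.
Qed.

(** Pulling back $C_1 \to N \to C$ makes $B$ the cone of $C_1 \to U$, where $U$ is an extension of
    $N$ by $A$. *)
Lemma F_extension A B C : triangle A B C -> F A -> F C -> F B.
Proof.
move=> t FA FC; have [C1 [N [MN t1 FC1]]] := F_resolve FC.
have [U [CUB AUN]] := triangle_pullback t t1.
apply/FacW; apply: F_cone CUB FC1 (F_extension_by_M AUN FA MN) _.
exact: H_extension t (Fac_heart FA) (Fac_heart FC).
Qed.

Hypothesis I_sub_F : subcat_incl (E_injective H) F.

(** Each cosyzygy gains one step in the chain of $\operatorname{Fac}_s(\mathcal{M})$, so after $d$
    of them any object of $H$ has reached $F$. *)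
Lemma injective_descent (K : D -> Prop) :
  (forall Y, F Y -> K Y) ->
  (forall Y I Z, extriangle H Y I Z -> E_injective H I -> K Z -> K Y) ->
  forall Y, H Y -> K Y.
Proof.
move=> K_base K_step Y HY.
suff K_Fac s : (s <= d)%N -> forall X, Fac H (d - s) M X -> K X.
  by apply: (K_Fac d) => //; rewrite subnn; apply/Fac0.
elim: s => [|s IHs] lt_sd X; first by rewrite subn0; apply: K_base.
move=> FX; have [I [Z [I_inj e]]] := enough_inj (Fac_heart FX).
apply: (K_step _ _ _ e I_inj); apply: IHs (ltnW lt_sd) _ _.
have [_ _ HZ t] := (extriangleP _ _ _ _).1 e.
rewrite (_ : d - s = (d - s.+1).+1)%N; last by lia.
exact: F_cone t FX (I_sub_F I_inj) HZ.
Qed.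

Lemma F_sub_T_class Y : F Y -> T_class H M Y.
Proof.
move=> FY; split=> [|[//|n] _ N MN]; first exact: Fac_heart FY.
elim: n Y FY => [|n IHn] Y FY; first exact: F_rigid.
have [I [Z [I_inj /extriangleP[HY _ HZ t]]]] := enough_inj (Fac_heart FY).
apply: hom_zero_to_source_shift (triangle_iter_shift n.+1 t) _ _.
  exact/IHn/FacW/(F_cone t FY (I_sub_F I_inj) HZ).
exact: (injective_vanishing (n := n.+2)) I_inj (MH MN) _.
Qed.

Lemma T_class_sub_F Y : T_class H M Y -> F Y.
Proof.
move=> TY; have [HY _] := TY; move: Y HY TY.
apply: injective_descent => // Y I Z /extriangleP[_ HI HZ t] I_inj FZ TY.
have [HY Y_van] := TY.
(* The cosyzygy inherits membership in $\mathcal{T}(\mathcal{M})$. *)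
have {}FZ : F Z.
  apply: FZ; split=> // i i_gt0 N MN.
  apply: hom_zero_to_cone (triangle_iter_shift i t) _ _.
    exact: injective_vanishing I_inj (MH MN) i_gt0.
  exact: (Y_van i.+1).
have [C [N [MN t1 FC]]] := F_resolve FZ.
(* $U$ is an extension of $I$ by $C$, hence in $F$; $Y \to U \to N$ splits since $Y \in
   \mathcal{T}(\mathcal{M})$, and swapping it makes $Y$ the cone of $N \to U$. *)
have [U [CUI YUN]] := triangle_pullback t t1.
have FU : F U by apply: F_extension CUI FC (I_sub_F I_inj).
apply/FacW; apply: F_cone (M_sub_Fac d MN) FU HY.
by apply: triangle_split_swap YUN _; apply: (Y_van 1%N).
Qed.

Lemma quasi_tilting_T_class : subcat_eq (T_class H M) F.
Proof. by move=> Y; split; [apply: T_class_sub_F | apply: F_sub_T_class]. Qed.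

Lemma M_resolved Y : M Y -> resolved H P d Y.
Proof.
move=> MY; apply: resolved_vanishing; first exact: MH.
(* Lowering the $\operatorname{Fac}$ index by one costs one degree; $s = d$ reaches all of $H$ in
   degree $d+1$. *)
suff van s : (s <= d)%N -> forall X, Fac H (d - s) M X ->
    hom_zero Y (iter s.+1 shift X).
  by move=> X HX; apply: van => //; rewrite subnn; apply/Fac0.
elim: s => [|s IHs] lt_sd X FX.
  by apply: F_rigid => //; move: FX; rewrite subn0.
have [I [Z [I_inj /extriangleP[_ _ HZ t]]]] := enough_inj (Fac_heart FX).
apply: hom_zero_to_source_shift (triangle_iter_shift s.+1 t) _ _.
  apply: IHs; first exact: ltnW.
  rewrite (_ : d - s = (d - s.+1).+1)%N; last by lia.
  exact: F_cone t FX (I_sub_F I_inj) HZ.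
exact: (injective_vanishing (n := s.+2)) I_inj (MH MY) _.
Qed.

Lemma F_envelope Y : H Y ->
  exists X S r, [/\ F X, triangle Y X S & coresolved H M r S].
Proof.
move: Y; apply: injective_descent => [Y FY|A I C].
  have [O O0] := zero_object D.
  exists Y, O, 0%N; split=> //; last exact: M_zero.
  exact: triangle_zero_right.
move=> /extriangleP[HA HI HC t] I_inj [X [S [r [FX CXS S_cores]]]].
have [X1 [N [MN t1 FX1]]] := F_resolve FX.
(* $W$ lengthens the coresolution by $W \to N \to S$; pulling back $X_1 \to W \to C$ along $I \to C$
   gives the new object $U \in F$ with $A \to U \to W$. *)
have [W [WNS XWC]] := triangle_compose t1 CXS.
have [U [XUI AUW]] := triangle_pullback t XWC.
exists U, W, r.+1; split=> //; first exact: F_extension XUI FX1 (I_sub_F I_inj).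
exists N, S; split=> //; apply/extriangleP; split=> //; last 1 first.
- by case: (r) S_cores => [/MH//|r'] /= [N' [Z [_ /extriangleP[]]]].
- exact: H_extension XWC (Fac_heart FX1) HC.
- exact: MH.
Qed.

Lemma P_coresolved Q : P Q -> exists r, coresolved H M r Q.
Proof.
move=> PQ; have [X [S [r [FX QXS S_cores]]]] := F_envelope (PH PQ).
have [X1 [N [MN t FX1]]] := F_resolve FX.
(* Both $\mathbb{E}(Q,X_1)$ and $\mathbb{E}(S,X_1)$ vanish, so $X_1 \to N \to X$ splits. *)
have MX : M X.
  apply: subcategory_summand M_sub MN (triangle_split_summand t _).
  apply: hom_zero_from_middle QXS _ _.
    exact: (P_proj (n := 1)) (Fac_heart FX1) _.
  exact: (coresolved_vanishing S_cores (F_sub_T_class FX1) (n := 1)).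
exists r.+1, X, S; split=> //; apply/extriangleP; split=> //.
- exact: PH.
- exact: MH.
- by case: (r) S_cores => [/MH//|r'] /= [N' [Z [_ /extriangleP[]]]].
Qed.

Lemma quasi_tilting_tilting : tilting H P d M.
Proof.
split=> [Y MY|i i_gt0 Y Z MY MZ|Q PQ].
- exact/(resolvedP H_zero _ _ P_sub PH)/M_resolved.
- by have [_] := F_sub_T_class (M_sub_Fac d MZ); apply.
- by have [r /coresolvedP] := P_coresolved PQ; exists r.
Qed.

End QuasiTilting.

Lemma T_class_quasi_tilting : (0 < d)%N -> contravariantly_finite M H ->
  subcat_eq (T_class H M) (Fac H d M) ->
  quasi_tilting H d M /\ subcat_incl (E_injective H) (Fac H d M).
Proof.
move=> d_gt0 M_cf TF.
have M_T N : M N -> T_class H M N by move=> MN; apply/TF/M_sub_Fac.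
split; last first.
  move=> I I_inj; apply/TF; split=> [|i i_gt0 N MN]; first by case: I_inj.
  exact: injective_vanishing I_inj (MH MN) i_gt0.
split=> [N MN|Y].
  split=> [|Z /TF[_ Z_van]]; first exact: M_sub_Fac.
  exact: (Z_van 1%N).
split=> [/TF TY|]; last exact: FacW.
apply: T_class_sub_Fac TY => // [i i_gt0 N N' MN /M_T[_]|{}Y TY Q PQ a].
  exact.
(* As $d > 0$, there is an extriangle $Z \to N \to Y$ with $N \in \mathcal{M}$, and maps from
   $\mathcal{P}$ lift to $N$. *)
have /TF := TY; case: (d) d_gt0 => // e _.
move=> /FacS[Z [N [MN /extriangleP[HZ _ _ [f [g [h fgh]]]] _]]].
have [|b ->] := dist_lift_cone (a := a) fgh.
  by rewrite (P_proj (n := 1) PQ HZ isT (_ \oc _)).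
by exists N, b, g.
Qed.

End Tilting.

Theorem theorem4p9 (D : triangulated) (P : full_subcat D)
  (P_presilting : presilting P)
  (P_contravariantly_finite : contravariantly_finite P (fun _ : D => True))
  (P_bounded : exists m : int, m < 0 /\
     forall i : int, i < m ->
       forall X Y : D, P X -> P Y -> hom_zero X (shiftn i Y))
  (P_t_structure : t_structure (Dle0 P) (Dge0 P))
  (P_non_degenerate : non_degenerate (Dle0 P) (Dge0 P))
  (d : nat) (d_gt0 : (0 < d)%N)
  (P_in_heart : subcat_incl P (extended_heart P d))
  (heart_enough_injectives : enough_injectives (extended_heart P d))
  (M : full_subcat D)
  (M_subcategory : subcategory M)
  (M_in_heart : subcat_incl M (extended_heart P d))
  (M_contravariantly_finite : contravariantly_finite M (extended_heart P d))
  (M_universal : E_universal (extended_heart P d) M) :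
  (tilting (extended_heart P d) P d M <->
   subcat_eq (T_class (extended_heart P d) M) (Fac (extended_heart P d) d M))
  /\
  (subcat_eq (T_class (extended_heart P d) M) (Fac (extended_heart P d) d M) <->
   (quasi_tilting (extended_heart P d) d M /\
    subcat_incl (E_injective (extended_heart P d))
      (Fac (extended_heart P d) d M))).
Proof.
have [P_sub _] := P_presilting.
have H_zero := extended_heart_zero P d_gt0.
have H_ext := extended_heart_extension (P := P) d_gt0.
have H_source := extended_heart_source (P := P) d_gt0.
have P_proj := extended_heart_projective (P := P) d_gt0.
have enough_proj := extended_heart_enough_projectives d_gt0
  P_contravariantly_finite P_in_heart.
have T_qt := T_class_quasi_tilting H_zero H_source P_proj enough_proj
  M_subcategory M_in_heart d_gt0 M_contravariantly_finite.
have qt_stable : quasi_tilting (extended_heart P d) d M ->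
    forall Y, Fac (extended_heart P d) d M Y ->
      Fac (extended_heart P d) d.+1 M Y.
  by move=> [_ F_eq] Y /F_eq.
have qt_rigid : quasi_tilting (extended_heart P d) d M ->
    forall N Y, M N -> Fac (extended_heart P d) d M Y -> hom_zero N (shift Y).
  by move=> [M_proj _] N Y /M_proj[_ +]; apply.
split; split; last 1 first.
- move=> [qt I_sub].
  exact: (quasi_tilting_T_class H_zero H_ext P_proj enough_proj
    heart_enough_injectives M_subcategory M_in_heart (qt_stable qt)
    (qt_rigid qt) I_sub).
- exact: (tilting_T_class H_zero H_source P_sub P_in_heart P_proj M_in_heart
    M_contravariantly_finite).
(* Tilting is deduced from $\mathcal{T}(\mathcal{M}) = \operatorname{Fac}_d(\mathcal{M})$ by way of
   quasi-tilting. *)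
- move=> /T_qt[qt I_sub].
  exact: (quasi_tilting_tilting H_zero H_ext P_sub P_in_heart P_proj enough_proj
    heart_enough_injectives M_subcategory M_in_heart (qt_stable qt)
    (qt_rigid qt) I_sub).
- exact: T_qt.
Qed.
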